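(* Let $X$ be a geodesic metric space. Then $X$ is not hyperbolic if and only if there exist a constant $K$, a sequence of positive real numbers $(L_n)_{n\in\mathbb{N}}$ with $L_n\to\infty$, and a sequence $(\gamma_n)_{n\in\mathbb{N}}$ of non-constant $L_n$-locally $(3,0)$-quasigeodesic loops in $X$ such that $\ell(\gamma_n)\le K L_n$ for every $n$ (with $K$ not depending on $n$).
   Context: A metric space is $\delta$-hyperbolic (for $\delta\ge 1$) if every geodesic triangle in it is $\delta$-thin, i.e. each side is contained in the $\delta$-neighbourhood of the union of the other two sides; it is hyperbolic if it is $\delta$-hyperbolic for some $\delta$. For $\lambda\ge1$, $\epsilon\ge0$, a $(\lambda,\epsilon)$-quasigeodesic in a metric space $X$ is a map $c:I\to X$ from a compact interval $I\subset\mathbb{R}$ satisfying $\frac1\lambda|s-t|-\epsilon\le d_X(c(s),c(t))\le\lambda|s-t|+\epsilon$ for all $s,t\in I$. For $L>0$, a path $c:[0,a]\to X$ is an $L$-locally $(\lambda,\epsilon)$-quasigeodesic if the restriction of $c$ to every subinterval of $[0,a]$ of length at most $L$ is a $(\lambda,\epsilon)$-quasigeodesic. It is an $L$-locally $(\lambda,\epsilon)$-quasigeodesic loop if in addition $c(0)=c(a)$. $\ell(c)$ denotes the length of the path $c$. *)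

(* Defs.v *)
From HB Require Import structures.
From mathcomp Require Import all_boot all_order all_algebra.
From mathcomp Require Import all_classical all_reals all_analysis.

Set Implicit Arguments.
Unset Strict Implicit.
Unset Printing Implicit Defensive.

Import Order.TTheory GRing.Theory Num.Theory.
Import numFieldNormedType.Exports.

Local Open Scope classical_set_scope.
Local Open Scope ring_scope.

(* A map from a compact interval `[a, b] to X is represented by a function
   R -> X together with the endpoints a and b; every definition below uses only
   its values on `[a, b]. *)

Section metric_geometry.
Context {R : realType} {X : metricType R}.
Implicit Types (x y z : X) (A B C S : set X) (c : R -> X).

Definition geodesic (l : R) c x y : Prop :=
  [/\ 0 <= l, c 0 = x, c l = y &
      forall s t : R, s \in `[0, l] -> t \in `[0, l] ->
        mdist (c s) (c t) = `|s - t|].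

Definition geodesic_segment x y S : Prop :=
  exists (l : R) (c : R -> X), geodesic l c x y /\ S = c @` `[0, l].

Definition neighbourhood (delta : R) A : set X :=
  [set p | exists2 q, A q & mdist p q <= delta].

Definition thin_triangle (delta : R) A B C : Prop :=
  [/\ A `<=` neighbourhood delta (B `|` C),
      B `<=` neighbourhood delta (C `|` A) &
      C `<=` neighbourhood delta (A `|` B)].

Definition quasigeodesic (lambda epsilon a b : R) c : Prop :=
  forall s t : R, s \in `[a, b] -> t \in `[a, b] ->
    lambda^-1 * `|s - t| - epsilon <= mdist (c s) (c t) /\
    mdist (c s) (c t) <= lambda * `|s - t| + epsilon.

Definition locally_quasigeodesic (L lambda epsilon a : R) c : Prop :=
  [/\ 0 <= a,
      {within `[0, a], continuous c} &
      forall u v : R, 0 <= u -> u <= v -> v <= a -> v - u <= L ->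
        quasigeodesic lambda epsilon u v c].

Definition locally_quasigeodesic_loop (L lambda epsilon a : R) c : Prop :=
  locally_quasigeodesic L lambda epsilon a c /\ c 0 = c a.

Definition nonconstant_on (a : R) c : Prop :=
  exists s t : R, [/\ s \in `[0, a], t \in `[0, a] & c s <> c t].

(* Metric analogues of [variation] and [total_variation]. *)
Definition polygonal_length (a b : R) c (s : seq R) : R :=
  \sum_(0 <= n < size s)
    mdist (c (nth b (a :: s) n)) (c (nth b (a :: s) n.+1)).

Definition path_length (a b : R) c : \bar R :=
  ereal_sup [set (polygonal_length a b c s)%:E | s in itv_partition a b].

End metric_geometry.

Definition geodesic_space (R : realType) (X : metricType R) : Prop :=
  forall x y : X, exists (l : R) (c : R -> X), geodesic l c x y.

Definition delta_hyperbolic (R : realType) (X : metricType R) (delta : R) :=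
  forall (x y z : X) (A B C : set X),
    geodesic_segment x y A -> geodesic_segment y z B ->
    geodesic_segment z x C -> thin_triangle delta A B C.

Definition hyperbolic (R : realType) (X : metricType R) : Prop :=
  exists2 delta : R, 1 <= delta & delta_hyperbolic X delta.

(* Main.v *)
Require Import Defs.
From HB Require Import structures.
From mathcomp Require Import all_boot all_order all_algebra.
From mathcomp Require Import all_classical all_reals all_analysis.
From mathcomp Require Import ring lra.

Import Order.TTheory GRing.Theory Num.Theory.
Import numFieldNormedType.Exports.

Local Open Scope classical_set_scope.
Local Open Scope ring_scope.

(** Both directions rest on comparing loops with geodesics.

    Suppose that triangles are delta-thin and that [c] is an [L]-locally
    (3,0)-quasigeodesic loop with [L] large compared with delta.  Let [m] be
    a point of the loop farthest from its base point, and let [x], [y] be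
    the points reached a fraction of [L] before and after [m].  Neither [x]
    nor [y] is farther from the base point than [m]; in a tree this forces
    the geodesics from [m] to [x], to [y] and to the base point to start
    with a common segment, and in a delta-hyperbolic space all three pass
    within delta of a point at some distance from [m]
    ([geodesic_near_branch]).  On the other hand the geodesic from [m] to
    [x] is close to the portion of the loop between them, as repeated
    bisection shows ([segment_near_lipschitz_path]).  So the loop visits
    almost the same point before and after [m], at some distance from [m]
    but within a window shorter than [L], contradicting the lower
    quasigeodesic bound ([hyperbolic_no_loop]).

    For the other direction, the constant 3 is that of nearest-point
    projections: if [q] is a point of a geodesic nearest to [p], then a
    geodesic from [p] to [q] continued along the given one is a
    (3,0)-quasigeodesic ([right_angle_quasigeodesic]).  Hence a closed
    polygon with sides of length at least [L], each of whose corners except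
    the base point arises in this way, is an [L]-locally (3,0)-quasigeodesic
    loop ([closed_polyline]).  Assume that, for some [M] and some
    sufficiently large constant [K], no such loop has [M <= L] and length at
    most [K * L] ([loop_free]).  Then the space is hyperbolic, for the
    following reasons.
    - Two geodesics that are [D]-close at the ends of a stretch of length
      [6 * D] come much closer inside it, since otherwise a quadrilateral
      between them is a forbidden loop ([approach]).
    - Consequently geodesics whose ends are [D]-close stay [3 * D]-close:
      the fattest place would again be surrounded by a forbidden
      quadrilateral ([arcs_fellow_travel]).
    - In a triangle, let [p] be the point of a side farthest, at distance
      [d], from the union of the other two.  By the previous items the
      triangle looks like a tripod with a hole of size comparable to [d]
      around [p]: within a bounded multiple of [d] each two of its sides
      come within [d / 9] of each other.  Cutting off the three corners
      there leaves a hexagon with right angles, which is a forbidden loop as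
      soon as [d > 9 * M] ([no_tripod], [side_close]).

    All estimates keep the ratio between the length of the loops and the
    scale [L] bounded, which is what makes a single [K] suffice. *)

Set Implicit Arguments.
Unset Strict Implicit.
Unset Printing Implicit Defensive.

(** * Lipschitz functions on an interval *)

(** The geometric proofs below carry many inequalities, most of them irrelevant
    to a given arithmetic step; naming the relevant ones keeps [lra] fast. *)
Tactic Notation "lra" "from" ne_hyp_list(hs) := clear - hs; lra.

Section Preliminaries.
Context {R : realType}.
Implicit Types (f g : R -> R) (a b k e l r s t u v : R).

(** Puts an absolute value in a form that [lra] can use. *)
Lemma norm_cases r : (0 <= r /\ `|r| = r) \/ (r <= 0 /\ `|r| = - r).
Proof. by case: (ger0P r) => h; [left | right; split=> //; exact: ltW]. Qed.

Lemma between_in_itv s t u l : 0 <= s <= l -> 0 <= t <= l ->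
  s <= u <= t \/ t <= u <= s -> 0 <= u <= l.
Proof. lra. Qed.

Lemma locally_lipschitz_continuous (Y : metricType R) (c : R -> Y) a b k e :
  0 < e ->
  (forall s t, a <= s <= b -> a <= t <= b -> `|s - t| <= e ->
     mdist (c s) (c t) <= k * `|s - t|) ->
  {within `[a, b], continuous c}.
Proof.
move=> e0 lip; apply/subspace_continuousP => s /=; rewrite in_itv/= => sab.
apply/metricType_numDomainType.cvgrPdist_lt => eps eps0.
have k1 : 0 < `|k| + 1 by rewrite ltr_wpDl.
have m0 : 0 < Num.min e (eps / (`|k| + 1)).
  by rewrite lt_min e0 divr_gt0.
rewrite near_withinE; near=> t.
rewrite /= in_itv/= => tab.
have st : `|s - t| < Num.min e (eps / (`|k| + 1)).
  by near: t; exact: (nbhsx_ballx s _ m0).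
move: st; rewrite lt_min => /andP[st1]; rewrite ltr_pdivlMr// => st2.
apply: le_lt_trans (lip _ _ sab tab (ltW st1)) _.
apply: le_lt_trans st2; rewrite mulrC ler_wpM2l//.
by rewrite (le_trans (ler_norm k))// lerDl.
Unshelve. all: by end_near. Qed.

Definition lipschitz1_on a b f :=
  forall s t, a <= s <= b -> a <= t <= b -> f s <= f t + `|s - t|.

Lemma lipschitz1_continuous a b f :
  lipschitz1_on a b f -> {within `[a, b], continuous f}.
Proof.
move=> lip; apply: (@locally_lipschitz_continuous R^o f a b 1 1) => //.
move=> s t sab tab _; rewrite /mdist/= mul1r.
have := lip s t sab tab; have := lip t s tab sab; rewrite (distrC t s).
by have := norm_cases (f t - f s); lra.
Qed.

Lemma lipschitz1_argmin a b f : a <= b -> lipschitz1_on a b f ->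
  exists2 t, a <= t <= b & forall s, a <= s <= b -> f t <= f s.
Proof.
move=> ab /lipschitz1_continuous /(EVT_min ab) [t]; rewrite in_itv/= => tab ft.
by exists t => // s sab; apply: ft; rewrite in_itv.
Qed.

Lemma lipschitz1_argmax a b f : a <= b -> lipschitz1_on a b f ->
  exists2 t, a <= t <= b & forall s, a <= s <= b -> f s <= f t.
Proof.
move=> ab /lipschitz1_continuous /(EVT_max ab) [t]; rewrite in_itv/= => tab ft.
by exists t => // s sab; apply: ft; rewrite in_itv.
Qed.

(** The value [v] is attained at the infimum of the set where [f <= v], because
    a Lipschitz function is continuous. *)
Lemma first_below a b f v : a <= b -> lipschitz1_on a b f ->
  v <= f a -> f b <= v ->
  exists2 t, a <= t <= b & f t = v /\ (forall s, a <= s <= t -> v <= f s).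
Proof.
move=> ab lip va bv.
pose S := [set t | a <= t <= b /\ f t <= v].
have S0 : S !=set0 by exists b; split=> //; rewrite ab lexx.
have lbS : lbound S a by move=> t [/andP[]].
have hS : has_inf S by split => //; exists a.
have at_ : a <= inf S by apply: lb_le_inf.
have tb : inf S <= b by apply: ge_inf; [exists a | split=> //; rewrite ab lexx].
have fS : f (inf S) <= v.
  apply/ler_addgt0Pr => e e0.
  have [t [tab ft] te] := inf_adherent e0 hS.
  have := ge_inf hS.2 (conj tab ft) => it.
  have := lip (inf S) t; have := norm_cases (inf S - t).
  rewrite tab at_ tb => h /(_ isT isT); lra.
have below s : a <= s < inf S -> v < f s.
  move=> /andP[as_ sS]; rewrite ltNge; apply/negP => fs.
  have : inf S <= s by apply: ge_inf; [exists a | split=> //; lra].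
  lra.
have fSv : f (inf S) = v.
  apply/eqP; rewrite eq_le fS/=; have [<-//|aS] := eqVneq a (inf S).
  have {}aS : a < inf S by rewrite lt_neqAle aS.
  apply/ler_addgt0Pr => e e0.
  pose s := Num.max a (inf S - e).
  have sS : s < inf S by rewrite gt_max aS; lra.
  have as_ : a <= s by rewrite le_max lexx.
  have se : inf S - e <= s by rewrite le_max lexx orbT.
  have := below s; have := lip s (inf S); have := norm_cases (s - inf S).
  rewrite as_ at_ tb sS => h /(_ _ isT) h2 /(_ isT); have := h2 ltac:(lra); lra.
exists (inf S); first by rewrite at_.
split=> // s /andP[as_]; rewrite le_eqVlt => /orP[/eqP->|sS].
  by rewrite fSv.
by apply/ltW/below; rewrite as_.
Qed.

Lemma lipschitz1_ivt a b f g : a <= b ->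
  lipschitz1_on a b f -> lipschitz1_on a b g ->
  f a <= g a -> g b <= f b -> exists2 t, a <= t <= b & f t = g t.
Proof.
move=> ab lf lg fga gfb.
pose h t := (f t - g t) / 2.
have lh : lipschitz1_on a b h.
  move=> s t sab tab; have := lf s t sab tab; have := lg t s tab sab.
  rewrite (distrC t s) /h; lra.
have [|t] := @IVT R h a b 0 ab (lipschitz1_continuous lh).
  by rewrite ge_min le_max /h; apply/andP; split; apply/orP; [left|right]; lra.
by rewrite in_itv/= => tab ht; exists t => //; move: ht; rewrite /h; lra.
Qed.

End Preliminaries.

(** * Geodesics and polygons with right angles *)

Section Arcs.
Context {R : realType} {X : metricType R}.
Implicit Types (x y z q : X) (c g : R -> X) (a b l L r s t u : R).

Definition geodesic_on l c := geodesic l c (c 0) (c l).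

Lemma geodesic_arc l c x y : geodesic l c x y -> geodesic_on l c.
Proof. by case=> l0 c0 cl iso; split. Qed.

Lemma arc_ge0 l c : geodesic_on l c -> 0 <= l.
Proof. by case. Qed.

Lemma arc_dist l c s t : geodesic_on l c -> 0 <= s <= l -> 0 <= t <= l ->
  mdist (c s) (c t) = `|s - t|.
Proof. by case=> _ _ _ iso sl tl; apply: iso; rewrite in_itv. Qed.

Lemma geodesic_on_rev l c :
  geodesic_on l c -> geodesic_on l (fun t => c (l - t)).
Proof.
move=> cg; have l0 := arc_ge0 cg; split=> // s t; rewrite !in_itv/= => sl tl.
by rewrite (arc_dist cg); [rewrite distrC; congr (`| _ |)| |]; lra.
Qed.

Lemma sub_arc l c s t : geodesic_on l c -> 0 <= s <= l -> 0 <= t <= l ->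
  exists c', [/\ geodesic_on `|s - t| c', c' 0 = c s, c' `|s - t| = c t &
    forall r, 0 <= r <= `|s - t| ->
      exists2 u, s <= u <= t \/ t <= u <= s & c' r = c u].
Proof.
move=> cg sl tl; have [st|ts] := leP s t.
- have e : `|s - t| = t - s by have := norm_cases (s - t); lra.
  rewrite e; exists (fun r => c (s + r)); split.
  + split=> [||//|u v]; [lra|by []|].
    rewrite !in_itv/= => ur vr; rewrite (arc_dist cg); [|lra|lra].
    by congr (`| _ |); lra.
  + by rewrite addr0.
  + by congr c; lra.
  + by move=> r rl; exists (s + r) => //; left; lra.
- have e : `|s - t| = s - t by have := norm_cases (s - t); lra.
  rewrite e; exists (fun r => c (s - r)); split.
  + split=> [||//|u v]; [lra|by []|].
    rewrite !in_itv/= => ur vr; rewrite (arc_dist cg); [|lra|lra].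
    by rewrite distrC; congr (`| _ |); lra.
  + by rewrite subr0.
  + by congr c; lra.
  + by move=> r rl; exists (s - r) => //; right; lra.
Qed.

Definition dist_arc l c q : R := inf [set mdist q (c t) | t in `[0, l]].

Lemma dist_arc_le l c q t : 0 <= t <= l -> dist_arc l c q <= mdist q (c t).
Proof.
move=> tl; apply: ge_inf.
  by exists 0 => _ [u _ <-]; exact: mdist_ge0.
by exists t => //=; rewrite in_itv.
Qed.

Lemma foot l c q : geodesic_on l c ->
  exists2 t, 0 <= t <= l & mdist q (c t) = dist_arc l c q.
Proof.
move=> cg; have l0 := arc_ge0 cg.
have lip : lipschitz1_on 0 l (fun t => mdist q (c t)).
  move=> s t sl tl; rewrite -(arc_dist cg sl tl) (metric_sym (c s)).
  exact: metric_triangle.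
have [t tl tmin] := lipschitz1_argmin l0 lip.
exists t => //; apply/eqP; rewrite eq_le dist_arc_le// andbT.
apply: lb_le_inf; first by exists (mdist q (c t)), t => //=; rewrite in_itv.
by move=> _ [s sl <-]; apply: tmin; move: sl; rewrite /= in_itv.
Qed.

Lemma dist_arc_ge0 l c q : geodesic_on l c -> 0 <= dist_arc l c q.
Proof. by move=> cg; have [t _ <-] := foot q cg; exact: mdist_ge0. Qed.

Lemma dist_arc_on l c t :
  geodesic_on l c -> 0 <= t <= l -> dist_arc l c (c t) = 0.
Proof.
move=> cg tl; apply/eqP; rewrite eq_le.
by rewrite -{1}(mdistxx (c t)) dist_arc_le//= dist_arc_ge0.
Qed.

Lemma dist_arc_triangle l c q q' : geodesic_on l c ->
  dist_arc l c q <= mdist q q' + dist_arc l c q'.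
Proof.
move=> cg; have [t tl <-] := foot q' cg.
exact: le_trans (dist_arc_le _ _ tl) (metric_triangle _ _ _).
Qed.

Lemma dist_arc_lipschitz l c l' c' : geodesic_on l c -> geodesic_on l' c' ->
  lipschitz1_on 0 l (fun t => dist_arc l' c' (c t)).
Proof.
move=> cg cg' s t sl tl; rewrite -(arc_dist cg sl tl) addrC.
exact: dist_arc_triangle.
Qed.

(** At the corner [c l = c' 0] one of the two sides is a shortest segment
    from its far end to the other side.  Since [l] and [l'] are the lengths
    of [c] and [c'], the inequalities say that the corner is a nearest
    point, of the second side to [c 0] or of the first side to [c' l']. *)
Definition right_angle l c l' c' :=
  (forall t, 0 <= t <= l' -> l <= mdist (c 0) (c' t)) \/
  (forall s, 0 <= s <= l -> l' <= mdist (c s) (c' l')).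

(** If the corner is nearest to [c 0], it is also a point of [c'] nearest to
    [c s], so [l - s] is at most the distance [d] from [c s] to [c' t], and then
    [t <= (l - s) + d <= 2 * d] by the triangle inequality.  The other case is
    symmetric. *)
Lemma right_angle_quasigeodesic l c l' c' s t :
  geodesic_on l c -> geodesic_on l' c' -> c' 0 = c l -> right_angle l c l' c' ->
  0 <= s <= l -> 0 <= t <= l' -> (l - s) + t <= 3 * mdist (c s) (c' t).
Proof.
move=> cg cg' e ra sl tl.
have ll : 0 <= l <= l by lra.
have l0 : 0 <= (0 : R) <= l by lra.
have ll' : 0 <= l' <= l' by lra.
have l0' : 0 <= (0 : R) <= l' by lra.
have n1 := norm_cases (s - l); have n2 := norm_cases (0 - t).
have n3 := norm_cases (0 - s); have n4 := norm_cases (t - l').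
have d1 := arc_dist cg sl ll; have d2 := arc_dist cg' l0' tl.
have d3 := arc_dist cg l0 sl; have d4 := arc_dist cg' tl ll'.
case: ra => [/(_ t tl)|/(_ s sl)] h.
- have := metric_triangle (c 0) (c s) (c' t).
  have := metric_triangle (c l) (c s) (c' t).
  rewrite -e in d1 *; rewrite (metric_sym (c' 0) (c s)); lra.
- have := metric_triangle (c s) (c' t) (c' l').
  have := metric_triangle (c s) (c' t) (c l).
  rewrite -e in d1 *; rewrite (metric_sym (c' t) (c' 0)); lra.
Qed.

(** In [polyline L x a l c] the broken line starts at [x] and has total length
    [a]; only its last side, [c] of length [l], is recorded because it alone
    matters for the next corner. *)
Inductive polyline L x : R -> R -> (R -> X) -> Prop :=
| polyline1 l c : geodesic_on l c -> L <= l -> c 0 = x -> polyline L x l l c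
| polylineS a l c l' c' : polyline L x a l c ->
    geodesic_on l' c' -> L <= l' -> c' 0 = c l -> right_angle l c l' c' ->
    polyline L x (a + l') l' c'.

Lemma polyline_arc L x a l c : polyline L x a l c -> geodesic_on l c /\ L <= l.
Proof. by case. Qed.

(** A window of length at most [L] has at most one corner in its interior,
    because each side is at least that long, so the lower bound only has to
    be checked across one right angle. *)
Lemma polyline_param L x a l c : polyline L x a l c ->
  exists g, [/\ g 0 = x, l <= a,
    forall s, 0 <= s <= l -> g (a - l + s) = c s,
    forall s t, 0 <= s -> s <= t -> t <= a -> mdist (g s) (g t) <= t - s &
    forall s t, 0 <= s -> s <= t -> t <= a -> t - s <= L ->
      t - s <= 3 * mdist (g s) (g t)].
Proof.
elim=> {a l c} [l c cg Ll c0|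
  a l c l' c' pl [g [g0 la gc gup glow]] cg' Ll' e ra].
- exists c; split=> //.
  + by move=> s _; congr c; lra.
  + move=> s t s0 st tl; rewrite (arc_dist cg); [|lra|lra].
    have := norm_cases (s - t); lra.
  + move=> s t s0 st tl _; rewrite (arc_dist cg); [|lra|lra].
    have := norm_cases (s - t); lra.
have [cg Ll] := polyline_arc pl.
have l0 := arc_ge0 cg; have l0' := arc_ge0 cg'.
have ga : g a = c' 0.
  by rewrite e -gc; [congr g; lra | rewrite l0 lexx].
pose h t := if t <= a then g t else c' (t - a).
have hg t : t <= a -> h t = g t by rewrite /h => ->.
have hc t : a <= t -> h t = c' (t - a).
  rewrite /h; case: ifP => // ta at_.
  have -> : t = a by apply/eqP; rewrite eq_le ta.
  by rewrite subrr.
exists h; split.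
- by rewrite hg//; lra.
- lra.
- by move=> s sl; rewrite hc; [congr c'|]; lra.
- move=> s t s0 st tl; have [ta|at_] := leP t a.
    rewrite !hg//; [exact: gup | lra].
  rewrite (hc t); last lra; have [sa|as_] := leP s a.
  + rewrite hg//; apply: le_trans (metric_triangle _ (g a) _) _.
    have := gup s a s0 sa (lexx _); rewrite ga (arc_dist cg'); [|lra|lra].
    have := norm_cases (0 - (t - a)); lra.
  + rewrite hc; last lra.
    rewrite (arc_dist cg'); [|lra|lra].
    have := norm_cases (s - a - (t - a)); lra.
- move=> s t s0 st tl stL; have [ta|at_] := leP t a.
    rewrite !hg//; [exact: glow | lra].
  rewrite (hc t); last lra; have [sa|as_] := leP s a.
  + have -> : h s = c (s - (a - l)).
      by rewrite hg// -gc; [congr g|]; lra.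
    have := @right_angle_quasigeodesic l c l' c' (s - (a - l)) (t - a).
    by move/(_ cg cg' e ra ltac:(lra) ltac:(lra)); lra.
  + rewrite hc; last lra.
    rewrite (arc_dist cg'); [|lra|lra].
    have := norm_cases (s - a - (t - a)); lra.
Qed.

Lemma polygonal_length_le g a b (s : seq R) :
  (forall u v, a <= u -> u <= v -> v <= b -> mdist (g u) (g v) <= v - u) ->
  itv_partition a b s -> polygonal_length a b g s <= b - a.
Proof.
rewrite /polygonal_length.
elim: s a => [a _ /itv_partition_nil ->|t s ih a lip p].
  by rewrite big_nil subrr.
have p' := itv_partition_cons p.
have tb := itv_partition_le p'.
have at_ : a <= t by case: p => /= /andP[/ltW].
rewrite /= big_nat_recl//=.
have := lip a t (lexx _) at_ tb.
have := ih t (fun u v tu => lip u v (le_trans at_ tu)) p'.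
rewrite (_ : \sum_(0 <= i < size s)
      mdist (g (nth b (t :: s) i)) (g (nth b (t :: s) i.+1)) =
    \sum_(0 <= i < size s) mdist (g (nth b (t :: s) i)) (g (nth b s i)))//.
lra.
Qed.

(** The corner at the base point may be arbitrary, because subintervals of
    [[0, a]] do not wrap around. *)
Lemma closed_polyline L a l c : 0 < L -> polyline L (c l) a l c ->
  exists g, [/\ locally_quasigeodesic_loop L 3 0 a g, nonconstant_on a g &
    (path_length 0 a g <= a%:E)%E].
Proof.
move=> L0 pl; have [cg Ll] := polyline_arc pl.
have [g [g0 la gc gup glow]] := polyline_param pl.
have l0 := arc_ge0 cg.
have up s t : 0 <= s <= a -> 0 <= t <= a -> mdist (g s) (g t) <= `|s - t|.
  move=> sa ta; have := norm_cases (s - t); have [st|ts] := leP s t.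
    have := gup s t; lra.
  rewrite metric_sym; have := gup t s; lra.
have low s t : 0 <= s <= a -> 0 <= t <= a -> `|s - t| <= L ->
    `|s - t| <= 3 * mdist (g s) (g t).
  move=> sa ta; have := norm_cases (s - t); have [st|ts] := leP s t.
    have := glow s t; lra.
  rewrite metric_sym; have := glow t s; lra.
exists g; split.
- split; last by rewrite g0 -gc; [congr g; lra | lra].
  split.
  + lra.
  + apply: (@locally_lipschitz_continuous _ _ _ _ _ 1 1) => // s t sa ta _.
    by rewrite mul1r; exact: up.
  + move=> u v u0 uv va uvL s t; rewrite !in_itv/= => suv tuv.
    have := up s t; have := low s t; have := norm_cases (s - t); lra.
- exists (a - L), a; split; [by rewrite in_itv/=; lra.. |] => eg.
  have := glow (a - L) a ltac:(lra) ltac:(lra) (lexx _) ltac:(lra).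
  by rewrite eg mdistxx; lra.
- apply: ge_ereal_sup => _ [s p <-]; rewrite lee_fin.
  have := polygonal_length_le _ p; rewrite subr0; apply.
  exact: gup.
Qed.

End Arcs.

(** * Geodesics in a space without short locally quasigeodesic loops *)

(** Below, [M] bounds from below the scale [L] of the excluded loops, and [K]
    their length relative to [L].  If the loops of the theorem do not exist,
    then for every [K] this holds as soon as [M] is large enough.  The bound
    [100 * 1000 <= K] leaves room for all the polygons constructed below: their
    sides have length at least [L] and their perimeters are less than
    [100 * 1000 * L]. *)
Definition loop_free (R : realType) (X : metricType R) (M K : R) :=
  [/\ geodesic_space X, 0 < M, 100 * 1000 <= K &
    forall (L a : R) (g : R -> X), M <= L ->
      locally_quasigeodesic_loop L 3 0 a g -> nonconstant_on a g ->
      (path_length 0 a g <= (K * L)%:E)%E -> False].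

Section Loop_free.
Context {R : realType} {X : metricType R}.
Implicit Types (x y z q : X) (c g : R -> X) (a b l D K L M r s t u v : R).

Lemma closed_polyline_long M K L a l c :
  loop_free X M K -> M <= L -> polyline L (c l) a l c -> K * L < a.
Proof.
move=> [_ M_gt0 _ no_loop] LL pl; rewrite ltNge; apply/negP => aK.
have [g [lg ng pg]] := closed_polyline (lt_le_trans M_gt0 LL) pl.
by apply: no_loop LL lg ng (le_trans pg _); rewrite lee_fin.
Qed.

Lemma connecting_arc x y : geodesic_space X -> exists c,
  [/\ geodesic_on (mdist x y) c, c 0 = x & c (mdist x y) = y].
Proof.
move=> hX; have [l [c cg]] := hX x y; have ca := geodesic_arc cg.
case: cg => l0 c0 cl iso.
have e : l = mdist x y.
  rewrite -c0 -cl (arc_dist ca); [|lra|lra].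
  have := norm_cases (0 - l); lra.
by exists c; rewrite -e.
Qed.

(** The loop runs from [c t1] along [c] to [c t2], then to its foot on [c'],
    along [c'] to the foot of [c t1], and back.  The corner [c t2] is a
    right angle because [f] is minimal there, the two feet are right angles
    by definition, and [c t1] is the base point. *)
Lemma quadrilateral_long M K l c l' c' L t1 t2 :
  let f t := dist_arc l' c' (c t) in
  loop_free X M K -> geodesic_on l c -> geodesic_on l' c' ->
  M <= L -> 0 <= t1 <= l -> 0 <= t2 <= l ->
  L <= f t1 -> L <= f t2 ->
  (forall t, t1 <= t <= t2 \/ t2 <= t <= t1 -> f t2 <= f t) ->
  L + f t1 + f t2 <= `|t1 - t2| ->
  K * L < 2 * (`|t1 - t2| + f t1 + f t2).
Proof.
move=> f H cg cg' LL t1l t2l Lf1 Lf2 f2 sep.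
have [hX M_gt0 _ _] := H; have L_gt0 := lt_le_trans M_gt0 LL.
have [r1 r1l e1] := foot (c t1) cg'; have [r2 r2l e2] := foot (c t2) cg'.
have [a1 [A1 b1 d1 i1]] := sub_arc cg t1l t2l.
have [a2 [A2 b2 d2]] := connecting_arc (c t2) (c' r2) hX.
have [a3 [A3 b3 d3 i3]] := sub_arc cg' r2l r1l.
have [a4 [A4 b4 d4]] := connecting_arc (c' r1) (c t1) hX.
rewrite -/(f t1) in e1; rewrite -/(f t2) in e2.
have r21 : `|t1 - t2| - f t1 - f t2 <= `|r2 - r1| <= `|t1 - t2| + f t1 + f t2.
  rewrite -(arc_dist cg t1l t2l) -(arc_dist cg' r2l r1l).
  rewrite -[in f t1]e1 -[in f t2]e2.
  have := metric_triangle (c t1) (c' r1) (c t2).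
  have := metric_triangle (c' r1) (c' r2) (c t2).
  have := metric_triangle (c' r2) (c t2) (c' r1).
  have := metric_triangle (c t2) (c t1) (c' r1).
  rewrite (metric_sym (c' r2) (c t2)) (metric_sym (c' r1) (c' r2)).
  by rewrite (metric_sym (c t2) (c t1)); lra from L_gt0.
rewrite e2 in A2 d2; rewrite metric_sym e1 in A4 d4.
have P1 : polyline L (a4 (f t1)) `|t1 - t2| `|t1 - t2| a1.
  by apply: polyline1 => //; [lra from sep Lf1 Lf2 L_gt0 | rewrite b1 d4].
have R2 : right_angle `|t1 - t2| a1 (f t2) a2.
  right => s sl; have [u ul ->] := i1 s sl.
  by rewrite d2; exact: le_trans (f2 u ul) (dist_arc_le _ _ r2l).
have P2 := polylineS P1 A2 Lf2 (etrans b2 (esym d1)) R2.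
have R3 : right_angle (f t2) a2 `|r2 - r1| a3.
  left => s sl; have [u /(between_in_itv r2l r1l) ul ->] := i3 s sl.
  by rewrite b2 dist_arc_le.
have Lr : L <= `|r2 - r1| by lra from r21 sep.
have P3 := polylineS P2 A3 Lr (etrans b3 (esym d2)) R3.
have R4 : right_angle `|r2 - r1| a3 (f t1) a4.
  right => s sl; have [u /(between_in_itv r2l r1l) ul ->] := i3 s sl.
  by rewrite d4 metric_sym dist_arc_le.
have P4 := polylineS P3 A4 Lf1 (etrans b4 (esym d3)) R4.
by have := closed_polyline_long H LL P4; lra from r21.
Qed.

(** Suppose that [f] stays above [L], and let [s] minimize it.  Whichever end of
    the stretch is farther from [s] is at distance at least [3 * D], enough for
    the side on [c'] of the quadrilateral between this end and [s] to have
    length at least [L]; its perimeter is at most [16 * D]. *)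
Lemma approach M K l c l' c' D L t1 t2 :
  let f t := dist_arc l' c' (c t) in
  loop_free X M K -> geodesic_on l c -> geodesic_on l' c' ->
  M <= L -> L <= D -> 16 * D <= K * L ->
  0 <= t1 -> t2 = t1 + 6 * D -> t2 <= l -> f t1 <= D -> f t2 <= D ->
  exists2 t, t1 <= t <= t2 & f t <= L.
Proof.
move=> f H cg cg' LL LD DK t10 e t2l f1 f2.
have [_ M_gt0 _ _] := H; have L_gt0 := lt_le_trans M_gt0 LL.
have fl := dist_arc_lipschitz cg cg'; rewrite -/f in fl.
have [s sl smin] : exists2 s, t1 <= s <= t2 &
    forall t, t1 <= t <= t2 -> f s <= f t.
  apply: lipschitz1_argmin; first lra.
  by move=> u v ul vl; apply: fl; lra.
exists s => //; rewrite leNgt; apply/negP => Ls.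
have fs1 := smin t1 ltac:(lra); have fs2 := smin t2 ltac:(lra).
have [h|h] := leP (t1 + 3 * D) s.
- have n : `|t1 - s| = s - t1 by have := norm_cases (t1 - s); lra.
  have := @quadrilateral_long _ _ l c l' c' L t1 s H cg cg' LL.
  rewrite -/(f t1) -/(f s) n => q.
  have : K * L < 2 * (s - t1 + f t1 + f s); last lra.
  apply: q; [lra.. | | lra].
  by move=> u ul; apply: smin; lra.
- have n : `|t2 - s| = t2 - s by have := norm_cases (t2 - s); lra.
  have := @quadrilateral_long _ _ l c l' c' L t2 s H cg cg' LL.
  rewrite -/(f t2) -/(f s) n => q.
  have : K * L < 2 * (t2 - s + f t2 + f s); last lra.
  apply: q; [lra.. | | lra].
  by move=> u ul; apply: smin; lra.
Qed.

(** The first point after [p] at distance [v] is a right angle for a segment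
    connecting it to its foot; [approach] shows that it comes soon. *)
Lemma approach_right M K l c l' c' D v p e :
  let f t := dist_arc l' c' (c t) in
  loop_free X M K -> geodesic_on l c -> geodesic_on l' c' ->
  M <= v -> v <= D -> 16 * D <= K * v ->
  0 <= p -> p <= e -> e <= l ->
  (forall t, p <= t <= e -> f t <= D) -> v <= f p -> f e <= v ->
  exists t, [/\ p <= t <= e, t <= p + 6 * D, f t = v &
    forall s, p <= s <= t -> v <= f s].
Proof.
move=> f H cg cg' Lv vD DK p0 pe el fD fp fe.
have [_ M_gt0 _ _] := H; have v0 := lt_le_trans M_gt0 Lv.
have fl := dist_arc_lipschitz cg cg'; rewrite -/f in fl.
have [t' t'p ft'] : exists2 t, p <= t <= e /\ t <= p + 6 * D & f t <= v.
  have [h|h] := leP e (p + 6 * D); first by exists e => //; split; lra.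
  have [|||t tl ft] :=
    @approach _ _ l c l' c' D v p _ H cg cg' Lv vD DK p0 erefl.
  - lra.
  - by apply: fD; lra.
  - by apply: fD; lra.
  - by exists t => //; split; lra.
have [||t tl [ft fs]] := @first_below _ p t' f v _ _ fp ft'.
- lra.
- by move=> s u sl ul; apply: fl; lra.
- by exists t; split=> //; lra.
Qed.

Lemma approach_left M K l c l' c' D v p e :
  let f t := dist_arc l' c' (c t) in
  loop_free X M K -> geodesic_on l c -> geodesic_on l' c' ->
  M <= v -> v <= D -> 16 * D <= K * v ->
  0 <= e -> e <= p -> p <= l ->
  (forall t, e <= t <= p -> f t <= D) -> v <= f p -> f e <= v ->
  exists t, [/\ e <= t <= p, p - 6 * D <= t, f t = v &
    forall s, t <= s <= p -> v <= f s].
Proof.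
move=> f H cg cg' Lv vD DK e0 ep pl fD fp fe.
pose g t := c (l - t).
have gK t : g (l - t) = c t by rewrite /g; congr c; lra.
have [||||||t] := @approach_right _ _ l g l' c' D v (l - p) (l - e) H
    (geodesic_on_rev cg) cg' Lv vD DK; rewrite ?gK //.
- lra.
- lra.
- lra.
- by move=> t tl; apply: fD; lra.
- move=> [tl t6 ft fs]; exists (l - t); split=> //; [lra.. |].
  by move=> s sl; have := fs (l - s); rewrite gK; apply; lra.
Qed.

(** Let [p] maximize [f] and put [v = f p / 3].  If [D < v], then [f] takes the
    value [v] on both sides of [p] within [6 * f p = 18 * v] of it; the
    quadrilateral between the first such points has sides at least [v] and
    perimeter at most [76 * v]. *)
Lemma arcs_fellow_travel M K l c l' c' D t1 t2 t :
  let f t := dist_arc l' c' (c t) in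
  loop_free X M K -> geodesic_on l c -> geodesic_on l' c' ->
  M <= D -> 0 <= t1 -> t2 <= l ->
  f t1 <= D -> f t2 <= D -> t1 <= t <= t2 -> f t <= 3 * D.
Proof.
move=> f H cg cg' LD t10 t2l f1 f2 tt.
have fl := dist_arc_lipschitz cg cg'; rewrite -/f in fl.
have [p pl pmax] : exists2 p, t1 <= p <= t2 &
    forall t, t1 <= t <= t2 -> f t <= f p.
  apply: lipschitz1_argmax; first by case/andP: tt; exact: le_trans.
  by move=> u v ul vl; apply: fl; lra.
apply: le_trans (pmax t tt) _ => {t tt}; rewrite leNgt; apply/negP => Dp.
have [v ev] : exists v, f p = 3 * v by exists (f p / 3); lra.
have Lv : M <= v by lra.
have [_ M_gt0 K_large _] := H; have v0 := lt_le_trans M_gt0 Lv.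
have f1v : f t1 <= v by lra.
have f2v : f t2 <= v by lra.
move: f1 f2 Dp LD => _ _ _ _ {D}.
have Kv : 100 * 1000 * v <= K * v by rewrite ler_wpM2r// ltW.
have vp : v <= f p by lra.
have DK : 16 * f p <= K * v by lra.
have [|||r [rl r6 fr frs]] :=
    approach_right H cg cg' Lv vp DK (p := p) (e := t2) _ _ t2l _ vp f2v.
- lra.
- lra.
- by move=> u ul; apply: pmax; lra.
have [|||s [sl s6 fs fss]] :=
    approach_left H cg cg' Lv vp DK (p := p) (e := t1) t10 _ _ _ vp f1v.
- lra.
- lra.
- by move=> u ul; apply: pmax; lra.
rewrite -/(f r) in fr; rewrite -/(f s) in fs.
have fsr u : s <= u <= r \/ r <= u <= s -> v <= f u.
  by move=> ul; have [up|pu] := leP u p; [apply: fss | apply: frs]; lra.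
have h1 : 2 * v <= r - p.
  have := fl p r ltac:(lra) ltac:(lra); have := norm_cases (p - r).
  by rewrite fr; lra.
have h2 : 2 * v <= p - s.
  have := fl p s ltac:(lra) ltac:(lra); have := norm_cases (p - s).
  by rewrite fs; lra.
have := @quadrilateral_long _ _ l c l' c' v s r H cg cg' Lv.
rewrite -/(f s) -/(f r) fr fs.
have -> : `|s - r| = r - s by have := norm_cases (s - r); lra.
move=> /(_ ltac:(lra) ltac:(lra) (lexx _) (lexx _) fsr ltac:(lra)); lra.
Qed.

(** The six sides are the stretch of [ca] from [t1] to [t2], a connecting
    segment to [cb], a stretch of [cb], a connecting segment to [cc], a
    stretch of [cc], and a connecting segment back to [ca].  The five last
    hypotheses are the right angles, in this order; the base point is
    [ca t1]. *)
Lemma hexagon_long M K (la lb lc : R) (ca cb cc : R -> X) v t1 t2 b1 b2 r1 r2 :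
  loop_free X M K ->
  geodesic_on la ca -> geodesic_on lb cb -> geodesic_on lc cc -> M <= v ->
  0 <= t1 <= la -> 0 <= t2 <= la -> 0 <= b1 <= lb -> 0 <= b2 <= lb ->
  0 <= r1 <= lc -> 0 <= r2 <= lc ->
  mdist (ca t2) (cb b1) = v -> mdist (cb b2) (cc r1) = v ->
  mdist (cc r2) (ca t1) = v ->
  v <= `|t1 - t2| -> v <= `|b1 - b2| -> v <= `|r1 - r2| ->
  (forall t, t1 <= t <= t2 \/ t2 <= t <= t1 -> v <= mdist (ca t) (cb b1)) ->
  (forall t, b1 <= t <= b2 \/ b2 <= t <= b1 -> v <= mdist (ca t2) (cb t)) ->
  (forall t, b1 <= t <= b2 \/ b2 <= t <= b1 -> v <= mdist (cb t) (cc r1)) ->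
  (forall t, r1 <= t <= r2 \/ r2 <= t <= r1 -> v <= mdist (cb b2) (cc t)) ->
  (forall t, r1 <= t <= r2 \/ r2 <= t <= r1 -> v <= mdist (cc t) (ca t1)) ->
  K * v < `|t1 - t2| + v + `|b1 - b2| + v + `|r1 - r2| + v.
Proof.
move=> H ga gb gc Lv t1l t2l b1l b2l r1l r2l e1 e2 e3 lt lb' lc' k1 k2 k3 k4 k5.
have [hX _ _ _] := H.
have [a1 [A1 x1 y1 i1]] := sub_arc ga t1l t2l.
have [a2 [A2 x2 y2]] := connecting_arc (ca t2) (cb b1) hX.
have [a3 [A3 x3 y3 i3]] := sub_arc gb b1l b2l.
have [a4 [A4 x4 y4]] := connecting_arc (cb b2) (cc r1) hX.
have [a5 [A5 x5 y5 i5]] := sub_arc gc r1l r2l.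
have [a6 [A6 x6 y6]] := connecting_arc (cc r2) (ca t1) hX.
rewrite e1 in A2 y2; rewrite e2 in A4 y4; rewrite e3 in A6 y6.
have P1 : polyline v (a6 v) `|t1 - t2| `|t1 - t2| a1.
  by apply: polyline1 => //; rewrite x1 y6.
have R2 : right_angle `|t1 - t2| a1 v a2.
  by right => s sl; have [u ul ->] := i1 s sl; rewrite y2; exact: k1.
have P2 := polylineS P1 A2 (lexx v) (etrans x2 (esym y1)) R2.
have R3 : right_angle v a2 `|b1 - b2| a3.
  by left => s sl; have [u ul ->] := i3 s sl; rewrite x2; exact: k2.
have P3 := polylineS P2 A3 lb' (etrans x3 (esym y2)) R3.
have R4 : right_angle `|b1 - b2| a3 v a4.
  by right => s sl; have [u ul ->] := i3 s sl; rewrite y4; exact: k3.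
have P4 := polylineS P3 A4 (lexx v) (etrans x4 (esym y3)) R4.
have R5 : right_angle v a4 `|r1 - r2| a5.
  by left => s sl; have [u ul ->] := i5 s sl; rewrite x4; exact: k4.
have P5 := polylineS P4 A5 lc' (etrans x5 (esym y4)) R5.
have R6 : right_angle `|r1 - r2| a5 v a6.
  by right => s sl; have [u ul ->] := i5 s sl; rewrite y6; exact: k5.
have P6 := polylineS P5 A6 (lexx v) (etrans x6 (esym y5)) R6.
exact: closed_polyline_long H Lv P6.
Qed.

End Loop_free.

(** * Thin triangles *)

Section Thin_triangles.
Context {R : realType} {X : metricType R}.
Implicit Types (x y z q : X) (c g : R -> X) (l D K L M s t u v e m p : R).

(** The point [m] will be one where a side of a triangle is equally close to
    both other sides, and [p] the point farthest from them.  If [m] were far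
    beyond [p], the part of the side from its end [e] to [m] would follow a
    single other side, first within [3 * (9 * v)], hence by [approach] within
    [v] somewhere between [p] and [m].  Being also within [v] at [e], it would
    be within [3 * v] at [p].  The constant 162 is [6 * 27]. *)
Lemma approach_before_center M K l c l' c' v e p m :
  let f t := dist_arc l' c' (c t) in
  loop_free X M K -> geodesic_on l c -> geodesic_on l' c' ->
  M <= v ->
  0 <= e -> e <= p -> m <= l -> f e <= v -> f m <= 9 * v -> 9 * v <= f p ->
  m <= p + 162 * v.
Proof.
move=> f H cg cg' Lv e0 ep ml fe fm fp.
have [_ M_gt0 K_large _] := H; have v0 := lt_le_trans M_gt0 Lv.
have Kv : 100 * 1000 * v <= K * v by rewrite ler_wpM2r// ltW.
rewrite leNgt; apply/negP => pm.
have f27 s : e <= s <= m -> f s <= 3 * (9 * v).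
  by apply: (arcs_fellow_travel H cg cg'); rewrite -?/(f _); lra.
have [|||||||s sl fs] := approach H cg cg' Lv (D := 3 * (9 * v))
   (t1 := p) (t2 := p + 162 * v).
- lra.
- lra.
- lra.
- lra.
- lra.
- by apply: f27; lra.
- by apply: f27; lra.
have : f p <= 3 * v by apply: (arcs_fellow_travel H cg cg' Lv e0 _ fe fs); lra.
lra.
Qed.

(** Up to [m] the distance is at most [27 * v] by fellow-travelling, and
    from [m] to [p] it grows from [9 * v] by at most [162 * v]; so
    [approach_left] applies with [D = 171 * v], and 1026 is [6 * 171]. *)
Lemma last_contact M K l c l' c' v e p m :
  let f t := dist_arc l' c' (c t) in
  loop_free X M K -> geodesic_on l c -> geodesic_on l' c' ->
  M <= v ->
  0 <= e -> e <= p -> e <= m -> p <= l -> m <= l -> p <= m + 162 * v ->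
  f e <= v -> f m <= 9 * v -> 9 * v <= f p ->
  exists t, [/\ e <= t <= p, p - 1026 * v <= t, f t = v &
    forall s, t <= s <= p -> v <= f s].
Proof.
move=> f H cg cg' Lv e0 ep em pl ml pm fe fm fp.
have [_ M_gt0 K_large _] := H; have v0 := lt_le_trans M_gt0 Lv.
have Kv : 100 * 1000 * v <= K * v by rewrite ler_wpM2r// ltW.
have f171 s : e <= s <= p -> f s <= 171 * v.
  move=> sl; have [sm|ms] := leP s m.
    have : f s <= 3 * (9 * v); last lra.
    by apply: (arcs_fellow_travel H cg cg' _ e0 ml _ fm); rewrite -?/(f _); lra.
  have := dist_arc_lipschitz cg cg' (s := s) (t := m) ltac:(lra) ltac:(lra).
  rewrite -/(f s) -/(f m); have := norm_cases (s - m); lra.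
have [|||t [tl t6 ft fs]] := approach_left H cg cg' Lv
   (D := 171 * v) _ _ e0 ep pl f171 _ fe.
- lra.
- lra.
- by rewrite -/(f p); lra.
by exists t; split=> //; lra.
Qed.

(** If [q] were too close to [c'], then [c t1] would be close to [c'] as well as
    [c t2], and fellow-travelling would bring [c p] too close to it. *)
Lemma foot_far M K l c l' c' v t1 t2 p q :
  let f t := dist_arc l' c' (c t) in
  loop_free X M K -> geodesic_on l c -> geodesic_on l' c' ->
  M <= v ->
  0 <= t1 <= l -> 0 <= t2 <= l -> t1 <= p <= t2 \/ t2 <= p <= t1 ->
  9 * v <= f p -> f t2 <= v -> mdist (c t1) q <= v -> 2 * v <= dist_arc l' c' q.
Proof.
move=> f H cg cg' Lv t1l t2l pt fp f2 q1.
have [_ M_gt0 _ _] := H; have v0 := lt_le_trans M_gt0 Lv.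
set k := dist_arc _ _ _.
have k0 : 0 <= k by exact: dist_arc_ge0.
have f1 : f t1 <= v + k.
  by apply: le_trans (dist_arc_triangle _ q cg') _; rewrite lerD2r.
have f2' : f t2 <= v + k by lra.
have Lvk : M <= v + k by lra.
have : f p <= 3 * (v + k); last lra.
by case: pt => pt; [apply: (arcs_fellow_travel H cg cg' Lvk _ _ f1 f2') |
                    apply: (arcs_fellow_travel H cg cg' Lvk _ _ f2' f1)]; lra.
Qed.

(** The points [ca t1] and [ca t2] are connected to their feet [cc r1] and
    [cb b2].  From [cc r1] follow [cc] towards its common end with [cb], until
    the first point [cc r2] at distance [v] from [cb], and let [cb b1] be its
    foot.  By [foot_far] neither [cc r1] nor [cb b2] is closer than [2 * v] to
    the other of these two sides, which keeps the hexagon from degenerating.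
    The point [cc r2] is not too far along: [cc r1] is within [2054 * v] of
    [cb], so the rest of [cc] stays within three times as much, and comes within
    [v] of [cb] after at most 6 times that distance. *)
Lemma no_tripod M K (la lb lc : R) (ca cb cc : R -> X) v t1 t2 p :
  loop_free X M K ->
  geodesic_on la ca -> geodesic_on lb cb -> geodesic_on lc cc -> cb lb = cc 0 ->
  M <= v -> 0 <= t1 -> t1 <= p -> p <= t2 -> t2 <= la ->
  9 * v <= dist_arc lb cb (ca p) -> 9 * v <= dist_arc lc cc (ca p) ->
  dist_arc lc cc (ca t1) = v -> dist_arc lb cb (ca t2) = v ->
  (forall s, t1 <= s <= p -> v <= dist_arc lc cc (ca s)) ->
  (forall s, p <= s <= t2 -> v <= dist_arc lb cb (ca s)) ->
  t2 - t1 <= 2052 * v -> False.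
Proof.
move=> H ga gb gc ebc Lv t10 t1p pt2 t2l fBp fCp fC1 fB2 nC nB t12.
have [_ M_gt0 K_large _] := H; have v0 := lt_le_trans M_gt0 Lv.
have Kv : 100 * 1000 * v <= K * v by rewrite ler_wpM2r// ltW.
have lb0 := arc_ge0 gb.
have h0 : dist_arc lb cb (cc 0) = 0.
  by rewrite -ebc dist_arc_on//; lra from lb0.
move=> {ebc}.
have t1l : 0 <= t1 <= la by lra from t10 t1p pt2 t2l.
have t2l' : 0 <= t2 <= la by lra from t10 t1p pt2 t2l.
have farB u : t1 <= u <= t2 -> v <= dist_arc lb cb (ca u).
  move=> /andP[t1u ut2]; have [pu|up] := leP p u.
    by apply: nB; rewrite pu.
  rewrite leNgt; apply/negP => /ltW fu.
  have : dist_arc lb cb (ca p) <= 3 * v; last by lra from fBp v0.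
  apply: (arcs_fellow_travel H ga gb Lv (le_trans t10 t1u) t2l fu).
    by rewrite fB2.
  by rewrite (ltW up).
have d12 : mdist (ca t1) (ca t2) = t2 - t1.
  rewrite (arc_dist ga)//; have := norm_cases (t1 - t2); lra from t1p pt2.
have t1t2 : v <= t2 - t1.
  have pl : 0 <= p <= la by lra from t10 t1p pt2 t2l.
  have := dist_arc_lipschitz ga gc pl t1l.
  rewrite fC1; have := norm_cases (p - t1); lra from fCp t1p pt2 v0.
have [r1 r1l er1] := foot (ca t1) gc; have [b2 b2l eb2] := foot (ca t2) gb.
rewrite fC1 in er1; rewrite fB2 in eb2.
have liph := dist_arc_lipschitz gc gb.
pose h s := dist_arc lb cb (cc s); rewrite -/h in liph.
have hr1 : 2 * v <= h r1.
  apply: (foot_far H ga gb Lv t1l t2l' (p := p)) => //; rewrite ?fB2 ?er1//.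
  by left; rewrite t1p.
have kb2 : 2 * v <= dist_arc lc cc (cb b2).
  apply: (foot_far H ga gc Lv t2l' t1l (p := p)) => //; rewrite ?fC1 ?eb2//.
  by right; rewrite t1p.
have hr1' : h r1 <= 2054 * v.
  have := dist_arc_le cb (cc r1) b2l; rewrite -/(h r1).
  have := metric_triangle (cc r1) (ca t1) (cb b2).
  have := metric_triangle (ca t1) (ca t2) (cb b2).
  by rewrite (metric_sym (cc r1) (ca t1)) d12 er1 eb2; lra from t12.
have [r1_0 r1lc] := andP r1l.
have [r2 [r2l r26 fr2 fsr2]] : exists r2, [/\ 0 <= r2 <= r1,
    r1 - 6 * (3 * (2054 * v)) <= r2, h r2 = v &
    forall s, r2 <= s <= r1 -> v <= h s].
  apply: (approach_left H gc gb Lv _ _ (lexx 0) r1_0 r1lc).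
  - by lra from v0.
  - by lra from Kv v0.
  - move=> s; apply: (arcs_fellow_travel H gc gb _ (lexx 0) r1lc _ hr1').
    + by lra from Lv v0.
    + by rewrite h0; lra from v0.
  - by rewrite -/(h r1); lra from hr1 v0.
  - by rewrite h0 ltW.
have [b1 b1l eb1] := foot (cc r2) gb; rewrite -/(h r2) fr2 in eb1.
have r2l' : 0 <= r2 <= lc by lra from r2l r1lc.
have r21 : v <= r1 - r2.
  have := liph r1 r2 r1l r2l'; rewrite fr2; have := norm_cases (r1 - r2).
  by lra from hr1 r2l.
have er : `|r2 - r1| = r1 - r2.
  by have := norm_cases (r2 - r1); lra from r21 v0.
have et : `|t1 - t2| = t2 - t1.
  by have := norm_cases (t1 - t2); lra from t1t2 v0.
have eb := arc_dist gb b2l b1l.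
have bb : v <= `|b2 - b1|.
  have := dist_arc_triangle (cb b2) (cb b1) gc.
  have := dist_arc_le cc (cb b1) r2l'.
  by rewrite eb (metric_sym (cb b1) (cc r2)) eb1; lra from kb2.
have bb' : `|b2 - b1| <= v + (t2 - t1) + v + (r1 - r2) + v.
  have := metric_triangle (cb b2) (ca t2) (cb b1).
  have := metric_triangle (ca t2) (ca t1) (cb b1).
  have := metric_triangle (ca t1) (cc r1) (cb b1).
  have := metric_triangle (cc r1) (cc r2) (cb b1).
  rewrite (metric_sym (cb b2) (ca t2)) (metric_sym (ca t2) (ca t1)).
  rewrite eb d12 er1 eb2 eb1 (arc_dist gc)// distrC er.
  by lra from v0.
have : K * v < `|t1 - t2| + v + `|b2 - b1| + v + `|r2 - r1| + v.
  apply: (hexagon_long H ga gb gc Lv t1l t2l' b2l b1l r2l' r1l eb2).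
  - by rewrite metric_sym.
  - by rewrite metric_sym.
  - by rewrite et.
  - by [].
  - by rewrite er.
  - move=> u ul; apply: le_trans (farB u _) (dist_arc_le _ _ b2l).
    by lra from ul t1t2 v0.
  - move=> u /(between_in_itv b2l b1l) ul.
    by rewrite -[leLHS]fB2 dist_arc_le.
  - move=> u /(between_in_itv b2l b1l) ul.
    by rewrite -[leLHS]fr2 metric_sym dist_arc_le.
  - move=> u ul; rewrite metric_sym.
    by apply: le_trans (fsr2 u _) (dist_arc_le _ _ b1l); lra from ul r21 v0.
  - move=> u /(between_in_itv r2l' r1l) ul.
    by rewrite -[leLHS]fC1 metric_sym dist_arc_le.
by rewrite et er; lra from Kv bb' t12 r26 v0.
Qed.

(** The maximum of the distance to the union of the two other sides is [9 * v].
    By the intermediate value theorem some point [m] of the side is equally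
    distant from both, at distance at most [9 * v].  On the part towards [ca 0]
    the side [cc] plays the role of the approached geodesic, and on the part
    towards [ca la] the side [cb] does; the latter case reduces to the former by
    reversing [ca]. *)
Lemma side_close M K (la lb lc : R) (ca cb cc : R -> X) t :
  loop_free X M K ->
  geodesic_on la ca -> geodesic_on lb cb -> geodesic_on lc cc ->
  ca la = cb 0 -> cb lb = cc 0 -> cc lc = ca 0 -> 0 <= t <= la ->
  Num.min (dist_arc lb cb (ca t)) (dist_arc lc cc (ca t)) <= 9 * M.
Proof.
move=> H ga gb gc eab ebc eca tl.
have la0 := arc_ge0 ga; have lb0 := arc_ge0 gb; have lc0 := arc_ge0 gc.
pose fB t := dist_arc lb cb (ca t); pose fC t := dist_arc lc cc (ca t).
have fC0 : fC 0 = 0 by rewrite /fC -eca dist_arc_on//; lra.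
have fBl : fB la = 0 by rewrite /fB eab dist_arc_on//; lra.
move=> {eab eca}.
have lipB : lipschitz1_on 0 la fB by exact: dist_arc_lipschitz.
have lipC : lipschitz1_on 0 la fC by exact: dist_arc_lipschitz.
have lipf : lipschitz1_on 0 la (fun t => Num.min (fB t) (fC t)).
  move=> s u sl ul; have := lipB s u sl ul; have := lipC s u sl ul.
  by rewrite addr_minl le_min !ge_min => h1 h2; apply/andP; split;
    apply/orP; [left | right].
have [p pl pmax] := lipschitz1_argmax la0 lipf.
apply: le_trans (pmax t tl) _; rewrite leNgt; apply/negP => {t tl}.
have [v ed] : exists v, Num.min (fB p) (fC p) = 9 * v.
  by exists (Num.min (fB p) (fC p) / 9); rewrite mulrC divfK.
rewrite ed ltr_pM2l// => /ltW Lv.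
have [_ M_gt0 _ _] := H; have v0 := lt_le_trans M_gt0 Lv.
have fBp : 9 * v <= fB p by rewrite -ed ge_min lexx.
have fCp : 9 * v <= fC p by rewrite -ed ge_min lexx orbT.
have [m ml em] : exists2 m, 0 <= m <= la & fC m = fB m.
  by apply: lipschitz1_ivt; rewrite // ?fC0 ?fBl; exact: dist_arc_ge0.
have fm : fC m <= 9 * v by have := pmax m ml; rewrite -em minxx ed.
have fm' : fB m <= 9 * v by rewrite -em.
have [p0 pla] := andP pl; have [m0 mla] := andP ml.
have fC0v : fC 0 <= v by rewrite fC0 ltW.
have mp := approach_before_center H ga gc Lv (lexx 0) p0 mla fC0v fm fCp.
pose cr u := ca (la - u).
have crK u : cr (la - u) = ca u by rewrite /cr; congr ca; lra.
have gr : geodesic_on la cr by exact: geodesic_on_rev.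
have [p0' pla'] : 0 <= la - p /\ la - p <= la by lra.
have [m0' mla'] : 0 <= la - m /\ la - m <= la by lra.
have pm : la - m <= (la - p) + 162 * v.
  apply: (approach_before_center H gr gb Lv (lexx 0) p0' mla'); rewrite ?crK//.
  by rewrite /cr subr0 -/(fB la) fBl ltW.
have pm1 : p <= m + 162 * v by lra.
have pm2 : la - p <= la - m + 162 * v by lra.
have [t1 [t1p t16 ft1 nt1]] :=
  last_contact H ga gc Lv (lexx 0) p0 m0 pla mla pm1 fC0v fm fCp.
have [|||t2 [t2p t26 ft2 nt2]] :=
  last_contact H gr gb Lv (lexx 0) p0' m0' pla' mla' pm2 _ _ _.
- by rewrite /cr subr0 -/(fB la) fBl ltW.
- by rewrite crK.
- by rewrite crK.
apply: (no_tripod H (t1 := t1) (t2 := la - t2) ga gb gc ebc Lv _ _ _ _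
  fBp fCp ft1 ft2 nt1).
- by case/andP: t1p.
- by case/andP: t1p.
- by lra from t2p.
- by lra from t2p.
- by move=> s sl; have := nt2 (la - s); rewrite crK; apply; lra from sl.
- by lra from t16 t26.
Qed.

End Thin_triangles.

Section Loop_free_hyperbolic.
Context {R : realType} {X : metricType R}.
Implicit Types (x y z q : X) (S : set X) (c : R -> X).
Implicit Types (K M l : R).

Lemma side_neighbourhood M K x y z (A B C : set X) : loop_free X M K ->
  geodesic_segment x y A -> geodesic_segment y z B -> geodesic_segment z x C ->
  A `<=` neighbourhood (Num.max 1 (9 * M)) (B `|` C).
Proof.
move=> H [la [ca [ga ->]]] [lb [cb [gb ->]]] [lc [cc [gc ->]]] _ [t tl <-].
move: tl; rewrite /= in_itv/= => tl.
have [oa ob oc] := And3 (geodesic_arc ga) (geodesic_arc gb) (geodesic_arc gc).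
have near_side l c : geodesic_on l c -> dist_arc l c (ca t) <= 9 * M ->
    exists2 q, (c @` `[0, l]) q & mdist (ca t) q <= Num.max 1 (9 * M).
  move=> cg close; have [u ul e] := foot (ca t) cg.
  exists (c u); first by exists u => //=; rewrite in_itv.
  by rewrite e le_max close orbT.
have : Num.min (dist_arc lb cb (ca t)) (dist_arc lc cc (ca t)) <= 9 * M.
  case: ga gb gc => [_ a0 al _] [_ b0 bl _] [_ c0 cl _].
  by apply: (side_close H oa ob oc) => //; rewrite ?a0 ?al ?b0 ?bl ?c0 ?cl.
rewrite ge_min => /orP[/(near_side _ _ ob)|/(near_side _ _ oc)] [q qS d].
  by exists q => //; left.
by exists q => //; right.
Qed.

Lemma loop_free_hyperbolic M K : loop_free X M K -> hyperbolic X.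
Proof.
move=> H; exists (Num.max 1 (9 * M)); first by rewrite le_max lexx.
move=> x y z A B C gA gB gC; split.
- exact: (side_neighbourhood H gA gB gC).
- exact: (side_neighbourhood H gB gC gA).
- exact: (side_neighbourhood H gC gA gB).
Qed.

End Loop_free_hyperbolic.

(** * Loops in hyperbolic spaces *)

Section Hyperbolic.
Context {R : realType} {X : metricType R}.
Implicit Types (x y z q : X) (S : set X) (c g : R -> X).
Implicit Types (a l L delta r s t u v : R).

Lemma geodesic_segment_sym x y S :
  geodesic_segment x y S -> geodesic_segment y x S.
Proof.
move=> [l [c [cg ->]]]; have oc := geodesic_arc cg.
have [l0 _ _ iso] := geodesic_on_rev oc; case: cg => _ c0 cl _.
exists l, (fun t => c (l - t)); split.
  by split=> //; rewrite ?subr0 ?subrr.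
apply/seteqP; split=> _ [t tl <-]; exists (l - t) => //.
- by move: tl; rewrite /= !in_itv/=; lra.
- by congr c; lra.
- by move: tl; rewrite /= !in_itv/=; lra.
Qed.

(** Bisect the parameter interval: by thinness [z] is within [delta] of a
    geodesic subtending one of the two halves.  After [N] steps the remaining
    geodesic has length at most [3 * (v - u) / 2 ^+ N], and its ends are on the
    path. *)
Lemma segment_near_lipschitz_path delta g N u v S z :
  geodesic_space X -> delta_hyperbolic X delta -> u <= v ->
  (forall s t, u <= s -> s <= t -> t <= v ->
     mdist (g s) (g t) <= 3 * (t - s)) ->
  geodesic_segment (g u) (g v) S -> S z ->
  exists2 w, u <= w <= v & mdist z (g w) <= delta * N%:R + 3 * (v - u) / 2 ^+ N.
Proof.
move=> hX hyp; elim: N u v S z => [|N ih] u v S z uv lip.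
  move=> [l [c [cg ->]]] [t tl <-]; exists u; first by rewrite lexx.
  move: tl; rewrite /= in_itv/= => tl; have oc := geodesic_arc cg.
  case: cg => l0 c0 cl _.
  have := lip u v (lexx _) uv (lexx _).
  have l00 : 0 <= (0 : R) <= l by rewrite lexx.
  have ll : 0 <= l <= l by rewrite lexx andbT.
  rewrite -c0 -cl (arc_dist oc l00 ll) (arc_dist oc tl l00) expr0 divr1 mulr0.
  have := norm_cases (0 - l); have := norm_cases (t - 0); lra from tl.
move=> gS Sz.
pose w := (u + v) / 2.
have [uw wv] : u <= w /\ w <= v by rewrite /w; lra.
have [l1 [c1 g1]] := hX (g v) (g w); have [l2 [c2 g2]] := hX (g w) (g u).
have s1 : geodesic_segment (g v) (g w) (c1 @` `[0, l1]) by exists l1, c1.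
have s2 : geodesic_segment (g w) (g u) (c2 @` `[0, l2]) by exists l2, c2.
have [/(_ z Sz)[q qS zq] _ _] := hyp _ _ _ _ _ _ gS s1 s2.
have half t : 3 * t / 2 ^+ N.+1 = 3 * (t / 2) / 2 ^+ N.
  by rewrite exprS invfM; field; rewrite expf_neq0.
have from_half a b : u <= a -> a <= b -> b <= v -> b - a = (v - u) / 2 ->
    (exists2 r, a <= r <= b &
       mdist q (g r) <= delta * N%:R + 3 * (b - a) / 2 ^+ N) ->
    exists2 r, u <= r <= v &
      mdist z (g r) <= delta * N.+1%:R + 3 * (v - u) / 2 ^+ N.+1.
  move=> ua ab bv e [r rab d]; exists r; first by lra from rab ua bv.
  have := metric_triangle z q (g r).
  by rewrite half -e mulrS mulrDr mulr1; lra from d zq.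
case: qS => qS.
- apply: (from_half w v) => //; first by rewrite /w; lra from uv.
  apply: (ih w v _ q wv _ (geodesic_segment_sym s1) qS) => s t ws st tv.
  by apply: lip => //; exact: le_trans ws.
- apply: (from_half u w) => //; first by rewrite /w; lra from uv.
  apply: (ih u w _ q uw _ (geodesic_segment_sym s2) qS) => s t us st tw.
  by apply: lip => //; exact: le_trans wv.
Qed.

(** Thinness of the triangle [m], [p], [x] puts [c r] near the side from [x]
    to [m] or near the side from [p] to [x].  In the second case the latter
    side would be longer than [mdist p m], since it passes near [c r], which
    lies almost as far from [p] as [m] does, and then still has to reach
    [x]. *)
Lemma geodesic_near_branch delta p m x l c r S :
  geodesic_space X -> delta_hyperbolic X delta ->
  geodesic l c m p -> 0 <= r <= l -> geodesic_segment x m S ->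
  mdist p x <= mdist p m -> 2 * r + 2 * delta < mdist m x ->
  exists2 q, S q & mdist (c r) q <= delta.
Proof.
move=> hX hyp cg rl gS px mx; have oc := geodesic_arc cg.
have [lb [cb gb]] := hX p x; have ob := geodesic_arc gb.
have sA : geodesic_segment m p (c @` `[0, l]) by exists l, c.
have sB : geodesic_segment p x (cb @` `[0, lb]) by exists lb, cb.
have [sideA _ _] := hyp _ _ _ _ _ _ sA sB gS.
have [|q] := sideA (c r); first by exists r => //=; rewrite in_itv.
move=> [[t tl <-]|qS] zq; last by exists q.
exfalso; move: tl; rewrite /= in_itv/= => tl.
case: cg gb => l0 c0 cl _ [lb0 b0 bl _].
have l00 : 0 <= (0 : R) <= l by rewrite lexx.
have ll : 0 <= l <= l by rewrite lexx andbT.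
have b00 : 0 <= (0 : R) <= lb by rewrite lexx.
have bb : 0 <= lb <= lb by rewrite lexx andbT.
have mp : mdist m p = l.
  rewrite -c0 -cl (arc_dist oc l00 ll); have := norm_cases (0 - l); lra from l0.
have px' : mdist p x = lb.
  rewrite -b0 -bl (arc_dist ob b00 bb); have := norm_cases (0 - lb).
  by lra from lb0.
have mr : mdist m (c r) = r.
  rewrite -c0 (arc_dist oc l00 rl); have := norm_cases (0 - r); lra from rl.
have rp : mdist (c r) p = l - r.
  rewrite -[in mdist _ p]cl (arc_dist oc rl ll); have := norm_cases (r - l).
  by lra from rl.
have pt : mdist p (cb t) = t.
  rewrite -b0 (arc_dist ob b00 tl); have := norm_cases (0 - t); lra from tl.
have tx : mdist (cb t) x = lb - t.
  rewrite -[in mdist _ x]bl (arc_dist ob tl bb); have := norm_cases (t - lb).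
  by lra from tl.
have := metric_triangle (c r) (cb t) p; rewrite rp (metric_sym _ p) pt.
have := metric_triangle m (c r) x; rewrite mr.
have := metric_triangle (c r) (cb t) x; rewrite tx.
by move: px mx; rewrite px' (metric_sym p m) mp; lra from zq.
Qed.

(** With [L = 9 * s], the loop reaches distance [3 * s] from its base point,
    hence its farthest point [g t0] has [t0] at least [s] away from both ends of
    [[0, a]].  The comparison point [c r] lies on a geodesic from [g t0] to the
    base point, at distance [r = s / 10] from [g t0]: small compared with the
    distance, at least [s / 3], from [g t0] to [g (t0 - s)] and [g (t0 + s)],
    but large compared with the error [11 * delta + 3 * s / 1024] left by ten
    bisections. *)
Lemma hyperbolic_no_loop delta L a g :
  geodesic_space X -> delta_hyperbolic X delta -> 1 <= delta ->
  100 * 1000 * delta <= L -> locally_quasigeodesic_loop L 3 0 a g ->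
  ~ nonconstant_on a g.
Proof.
move=> hX hyp d1 dL [[a0 _ loc] loop] [s1 [s2 [s1a s2a ne]]].
rewrite !in_itv/= in s1a s2a.
have qg s t : 0 <= s -> s <= t -> t <= a -> t - s <= L ->
    t - s <= 3 * mdist (g s) (g t) /\ mdist (g s) (g t) <= 3 * (t - s).
  move=> s0 st ta stL; have := loc s t s0 st ta stL s t.
  rewrite !in_itv/= !lexx st => /(_ isT isT).
  have := norm_cases (s - t); lra from st.
have La : L < a.
  rewrite ltNge; apply/negP => aL.
  have := qg 0 a (lexx _) a0 (lexx _); rewrite subr0 => /(_ aL).
  rewrite loop mdistxx => -[a_le _]; apply: ne; congr g.
  by lra from s1a s2a a_le.
have L0 : 0 < L by lra from d1 dL.
have [s es] : exists s, L = 9 * s by exists (L / 9); lra from L0.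
pose f t := mdist (g 0) (g t).
have cf : {within `[0, a], continuous f}.
  apply: (@locally_lipschitz_continuous _ R^o _ _ _ 3 L) => // u t ua ta utL.
  have uv : mdist (g u) (g t) <= 3 * `|u - t|.
    have := norm_cases (u - t); have [ut|tu] := leP u t.
      have := qg u t; lra from ua ta utL ut.
    rewrite metric_sym; have := qg t u; lra from ua ta utL tu.
  apply: le_trans uv; rewrite [leLHS](_ : _ = `|f t - f u|)// /f.
  have := metric_triangle (g 0) (g u) (g t).
  have := metric_triangle (g 0) (g t) (g u); rewrite (metric_sym (g t)).
  by have := norm_cases (mdist (g 0) (g t) - mdist (g 0) (g u)); lra from L0.
have [t0] := EVT_max a0 cf; rewrite in_itv/= => t0a t0max.
have fmax t : 0 <= t <= a -> f t <= f t0.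
  by move=> ta; apply: t0max; rewrite in_itv.
have ft0 : 3 * s <= f t0.
  have := fmax L; have := qg 0 L; rewrite -/(f L); lra from La L0 es.
have t0s : s <= t0.
  rewrite leNgt; apply/negP => ts; have := qg 0 t0; rewrite -/(f t0).
  by lra from ts t0a es ft0 L0.
have t0s' : t0 <= a - s.
  rewrite leNgt; apply/negP => ts; have := qg t0 a.
  by rewrite metric_sym -loop -/(f t0); lra from ts t0a es ft0 L0.
have [l [c cg]] := hX (g t0) (g 0); have oc := geodesic_arc cg.
have lf : l = f t0.
  case: cg => l0 c0 cl _; rewrite /f metric_sym -c0 -cl.
  rewrite (arc_dist oc) ?lexx ?andbT//; have := norm_cases (0 - l).
  by lra from l0.
pose r := s / 10.
have rl : 0 <= r <= l by rewrite lf /r; lra from ft0 L0 es.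
have branch u v : 0 <= u -> u <= v -> v <= a -> v - u = s -> t0 = u \/ t0 = v ->
    exists2 w, u <= w <= v & mdist (c r) (g w) <= 11 * delta + 3 * s / 1024.
  move=> u0 uv va vu ut.
  have [l' [c' cg']] := hX (g u) (g v).
  have S1 : geodesic_segment (g u) (g v) (c' @` `[0, l']) by exists l', c'.
  have [duv _] := qg u v u0 uv va ltac:(lra from vu es L0).
  have du : 2 * r + 2 * delta < mdist (g u) (g v).
    by rewrite /r; lra from duv vu dL es d1.
  have [q qS dq] : exists2 q, (c' @` `[0, l']) q & mdist (c r) q <= delta.
    case: ut => ut; rewrite ut in cg fmax.
    - have S1' := geodesic_segment_sym S1.
      apply: (geodesic_near_branch hX hyp cg rl S1') => //.
      by apply: fmax; lra from u0 uv va.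
    - apply: (geodesic_near_branch hX hyp cg rl S1); last by rewrite metric_sym.
      by apply: fmax; lra from u0 uv va.
  have [w uwv dw] := @segment_near_lipschitz_path delta g 10 u v _ q hX hyp uv
    (fun s t us st tv => (qg s t (le_trans u0 us) st (le_trans tv va)
       ltac:(lra from us st tv vu es L0)).2) S1 qS.
  exists w => //; have := metric_triangle (c r) q (g w).
  have e1024 : (2 : R) ^+ 10 = 1024 by ring.
  by move: dw; rewrite e1024 vu; lra from dq.
have [u ul du] := branch (t0 - s) t0 ltac:(lra from t0s) ltac:(lra from L0 es)
  ltac:(lra from t0a) ltac:(ring) (or_intror erefl).
have [v vl dv] := branch t0 (t0 + s) ltac:(lra from t0a) ltac:(lra from L0 es)
  ltac:(lra from t0s') ltac:(ring) (or_introl erefl).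
have [uv _] := qg u v ltac:(lra from ul t0s) ltac:(lra from ul vl)
  ltac:(lra from vl t0s') ltac:(lra from ul vl L0 es).
have [_ ut] := qg u t0 ltac:(lra from ul t0s) ltac:(lra from ul)
  ltac:(lra from t0a) ltac:(lra from ul L0 es).
have mr : mdist (g t0) (c r) = r.
  case: cg => l0 c0 cl _; rewrite -c0 (arc_dist oc) ?lexx ?l0//.
  by have := norm_cases (0 - r); lra from rl.
have := metric_triangle (g u) (c r) (g v); rewrite (metric_sym (g u) (c r)).
have := metric_triangle (g t0) (g u) (c r); rewrite mr (metric_sym (g u) (c r)).
rewrite (metric_sym (g t0) (g u)) /r.
by lra from ut uv du dv ul vl dL es d1.
Qed.

End Hyperbolic.

(** * Non-hyperbolicity and loops *)

Unset Implicit Arguments.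

Theorem theorem1p4 (R : realType) (X : metricType R) (hX : geodesic_space X) :
  ~ hyperbolic X <->
  exists (K : R) (L : nat -> R) (a : nat -> R) (gamma : nat -> R -> X),
    [/\ forall n, 0 < L n,
        L n @[n --> \oo] --> +oo,
        forall n, locally_quasigeodesic_loop (L n) 3 0 (a n) (gamma n),
        forall n, nonconstant_on (a n) (gamma n) &
        forall n, (path_length 0 (a n) (gamma n) <= (K * L n)%:E)%E].
Proof.
split=> [not_hyp|[K [L [a [g [_ Loo lg ng _]]]]] [delta d1 hyp]]; last first.
  have [n dL] : exists n, 100 * 1000 * delta <= L n.
    have /cvgryPge/(_ (100 * 1000 * delta)) [n _ nL] := Loo.
    by exists n; apply: nL => /=.
  exact: (hyperbolic_no_loop hX hyp d1 dL (lg n) (ng n)).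
have loop n : exists p : R * R * (R -> X),
    [/\ n.+1%:R <= p.1.1, locally_quasigeodesic_loop p.1.1 3 0 p.1.2 p.2,
      nonconstant_on p.1.2 p.2 &
      (path_length 0 p.1.2 p.2 <= (100 * 1000 * p.1.1)%:E)%E].
  apply: contrapT => no_loop; apply: not_hyp.
  apply: (@loop_free_hyperbolic _ _ n.+1%:R (100 * 1000)); split=> //.
  by move=> L a g nL lg ng pg; apply: no_loop; exists (L, a, g).
have [p pP] := choice loop.
exists (100 * 1000), (fun n => (p n).1.1), (fun n => (p n).1.2).
exists (fun n => (p n).2).
split=> [n| |n|n|n]; try by case: (pP n).
- by case: (pP n) => pn _ _ _; apply: lt_le_trans pn; rewrite ltr0n.
- apply/cvgryPge => A; near=> n; case: (pP n) => pn _ _ _; apply: le_trans pn.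
  have nA : A <= n%:R by near: n; exact: nbhs_infty_ger.
  by apply: le_trans nA _; rewrite ler_nat.
Unshelve. all: by end_near. Qed.
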